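(* Let $X$ and $Y$ be Banach spaces, let $\mu_0$ be a Borel probability measure on $X$, and let $\Phi : X\times Y \to \mathbb{R}$ satisfy the following conditions. (A) There is a positive non-decreasing function $f_1:\mathbb{R}_+\to[1,\infty)$ such that for every $r>0$ there is a constant $M(r)\in\mathbb{R}$ with $\Phi(u;y)\ge M(r)-\log\left(f_1(\|u\|_X)\right)$ for all $u\in X$ and all $y\in B_Y(r)$. (B) For every $r>0$ there is a constant $K(r)>0$ with $\Phi(u;y)\le K(r)$ for all $u\in B_X(r)$ and all $y\in B_Y(r)$. (C) There is a positive non-decreasing function $f_2:\mathbb{R}_+\to\mathbb{R}_+$ such that for every $r>0$ there is a constant $C(r)\in\mathbb{R}$ with $|\Phi(u;y_1)-\Phi(u;y_2)|\le C(r)f_2(\|u\|_X)\|y_1-y_2\|_Y$ for all $y_1,y_2\in B_Y(r)$ and all $u\in X$. For $y,y'\in Y$ let $\mu^y$ and $\mu^{y'}$ be the measures defined via Bayes' rule $$\frac{d\mu^y}{d\mu_0}(u)=\frac{1}{Z(y)}\exp(-\Phi(u;y)),\qquad Z(y)=\int_X\exp(-\Phi(u;y))\,d\mu_0(u),$$ both absolutely continuous with respect to $\mu_0$. (i) If $f_2(\|\cdot\|_X)f_1(\|\cdot\|_X)\in L^1(X,\mu_0)$, then for every $r>0$ there exists a constant $C(r)>0$ such that $d_{TV}(\mu^y,\mu^{y'})\le C(r)\|y-y'\|_Y$ for all $y,y'\in B_Y(r)$. (ii) If instead $(f_2(\|\cdot\|_X))^2f_1(\|\cdot\|_X)\in L^1(X,\mu_0)$,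 then for every $r>0$ there exists a constant $C'(r)>0$ such that $d_H(\mu^y,\mu^{y'})\le C'(r)\|y-y'\|_Y$ for all $y,y'\in B_Y(r)$.
   Context: $\mathbb{R}_+=[0,\infty)$. $B_X(r)$ and $B_Y(r)$ denote the open balls of radius $r$ centered at the origin in $X$ and $Y$. $X$ is not assumed separable. All probability measures considered are complete. For probability measures $\mu_1,\mu_2$ absolutely continuous with respect to a measure $\nu$ on $X$, $$d_{TV}(\mu_1,\mu_2)=\frac12\int_X\left|\frac{d\mu_1}{d\nu}-\frac{d\mu_2}{d\nu}\right|d\nu,\qquad d_H(\mu_1,\mu_2)=\left(\frac12\int_X\left(\sqrt{\frac{d\mu_1}{d\nu}}-\sqrt{\frac{d\mu_2}{d\nu}}\right)^2d\nu\right)^{1/2};$$ these do not depend on the choice of $\nu$. *)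

(* Defs.v *)
From HB Require Import structures.
From mathcomp Require Import all_boot all_order all_algebra.
From mathcomp Require Import all_classical all_reals all_analysis.
Set Implicit Arguments.
Unset Strict Implicit.
Unset Printing Implicit Defensive.
Import Order.TTheory GRing.Theory Num.Theory.
Import numFieldNormedType.Exports.
Local Open Scope classical_set_scope.
Local Open Scope ring_scope.

Notation borel X := (g_sigma_algebraType (@open X)).

(* The Caratheodory extension of a probability measure is its completion; the
   carrier [completed_type P] is convertible to that of [P]. *)
Notation completed_type P := (caratheodory_type (P^*)%mu).

Section completion.
Context d (T : measurableType d) (R : realType) (P : probability T R).

Definition completion_fun : set (completed_type P) -> \bar R :=
  @completed_measure_extension _ _ _ P.

HB.instance Definition _ := Measure.on completion_fun.

Let completion_setT : completion_fun [set: _] = 1%E.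
Proof.
rewrite /completion_fun /completed_measure_extension measurable_mu_extE//.
exact: probability_setT.
Qed.

HB.instance Definition _ :=
  Measure_isProbability.Build _ _ _ completion_fun completion_setT.

Definition completion : probability (completed_type P) R := completion_fun.

End completion.

Section distances.
Local Open Scope ereal_scope.
Local Open Scope charge_scope.
Context d (T : measurableType d) (R : realType).

Definition density (nu : {sigma_finite_measure set T -> \bar R})
    (mu : probability T R) : T -> \bar R :=
  'd (charge_of_finite_measure mu) '/d nu.

(* In both distances [nu] is a reference measure meant to dominate [mu1] and
   [mu2]; the library's Radon-Nikodym derivative is a junk value otherwise. *)
Definition dTV (nu : {sigma_finite_measure set T -> \bar R})
    (mu1 mu2 : probability T R) : \bar R :=
  2^-1%:E * \int[nu]_x `|density nu mu1 x - density nu mu2 x|.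

Definition dH (nu : {sigma_finite_measure set T -> \bar R})
    (mu1 mu2 : probability T R) : \bar R :=
  sqrte (2^-1%:E *
    \int[nu]_x (sqrte (density nu mu1 x) - sqrte (density nu mu2 x)) ^+ 2).

End distances.

Section bayes.
Local Open Scope ereal_scope.
Context d (T : measurableType d) (R : realType) (Y : Type).

Definition evidence (mu0 : probability T R) (Phi : T -> Y -> R) (y : Y) :
    \bar R :=
  \int[mu0]_u (expR (- Phi u y))%:E.

Definition is_posterior (mu0 : probability T R) (Phi : T -> Y -> R) (y : Y)
    (muy : probability T R) : Prop :=
  muy `<< mu0 /\
  {ae mu0, forall u, density mu0 muy u =
    (evidence mu0 Phi y)^-1 * (expR (- Phi u y))%:E}.

End bayes.

(* Main.v *)
Require Import Defs.
From mathcomp Require Import all_boot all_order all_algebra.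
From mathcomp Require Import all_classical all_reals all_analysis.
From mathcomp Require Import measurable_realfun ring lra.
Import Order.TTheory GRing.Theory Num.Theory.
Import numFieldNormedType.Exports.
Local Open Scope classical_set_scope.
Local Open Scope ring_scope.

(** Write p_y = exp(-Phi(.;y)), so that the posterior density is
    q_y = p_y / Z(y), and fix y, y' in the ball of radius r.

    Condition (A) gives p_y <= exp(-M) f1, and exp is Lipschitz with constant
    B below the level B.  Together with (C), this yields the pointwise bounds
    |p_y - p_y'| <= c f1 f2 |y - y'| and
    (sqrt p_y - sqrt p_y')^2 <= c f1 f2^2 |y - y'|^2, whose right-hand sides
    are integrable by assumption ([likelihood_dist_le],
    [sqrt_likelihood_dist_le]).  Condition (B) bounds Z(y) from below
    uniformly in y: p_y >= exp(-K) on a ball of positive mu0-mass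
    ([evidence_lower_bound]).  It remains to divide by the normalizations.

    For the total variation distance, the identity
    Z (q - q') = (p - p') - (Z - Z') q' and |Z - Z'| <= int |p - p'| give
    int |q - q'| <= 2 int |p - p'| / Z ([normalized_L1_dist]).

    For the Hellinger distance, expanding the square shows
    (sqrt p - sqrt p')^2 = s (sqrt q - sqrt q')^2 + (Z - s) q + (Z' - s) q'
    with s = sqrt (Z Z').  The last two terms integrate to
    (sqrt Z - sqrt Z')^2 >= 0, whence
    int (sqrt q - sqrt q')^2 <= int (sqrt p - sqrt p')^2 / s
    ([normalized_Hellinger_dist]).

    Phi(.;y) need not be measurable, but the Radon-Nikodym derivative, equal
    almost everywhere to p_y / Z(y), is.  For this reason the integrals below
    are those of q and of the integrable dominating functions, while p enters
    through pointwise bounds only. *)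

Set Implicit Arguments.
Unset Strict Implicit.

(** * Lipschitz bounds for likelihoods *)

(** By convexity: if a <= b, then 1 - exp (a - b) <= b - a. *)
Lemma dist_expR_le (R : realType) (a b B : R) :
  expR a <= B -> expR b <= B -> `|expR a - expR b| <= B * `|a - b|.
Proof.
wlog leab : a b / a <= b.
  move=> hw ha hb; have [ab|/ltW ba] := leP a b; first exact: hw.
  by rewrite distrC (distrC a); exact: hw.
move=> _ hb.
have hle : expR a <= expR b by rewrite ler_expR.
rewrite distrC (distrC a) !ger0_norm ?subr_ge0//.
have -> : expR b - expR a = expR b * (1 - expR (a - b)).
  by rewrite mulrBr mulr1 -expRD subrKC.
apply: ler_pM => //.
  by rewrite subr_ge0 -[leRHS]expR0 ler_expR subr_le0.
by have := expR_ge1Dx (a - b); lra.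
Qed.

Section likelihoods.
Variable R : realType.
Implicit Types a b F M : R.

Lemma likelihood_le a F M : 1 <= F -> M - ln F <= a ->
  expR (- a) <= expR (- M) * F.
Proof.
move=> F1 Ma; have F0 : 0 < F by exact: lt_le_trans F1.
by rewrite -[X in _ * X](lnK F0) -expRD ler_expR; lra.
Qed.

Lemma likelihood_dist_le a b F M : 1 <= F -> M - ln F <= a -> M - ln F <= b ->
  `|expR (- a) - expR (- b)| <= expR (- M) * F * `|a - b|.
Proof.
move=> F1 Ma Mb; rewrite (_ : a - b = - (- a - - b)); last by ring.
by rewrite normrN; apply: dist_expR_le; exact: likelihood_le.
Qed.

Lemma sqrt_expR (x : R) : Num.sqrt (expR x) = expR (x / 2).
Proof.
rewrite (_ : expR x = expR (x / 2) ^+ 2); last by rewrite expr2 -expRD -splitr.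
by rewrite sqrtr_sqr ger0_norm// expR_ge0.
Qed.

(** The square root of exp (-a) is exp (-a/2), bounded by
    sqrt (exp (-M) F); the Lipschitz bound for exp is applied at these halves
    and squared. *)
Lemma sqrt_likelihood_dist_le a b F M :
  1 <= F -> M - ln F <= a -> M - ln F <= b ->
  (Num.sqrt (expR (- a)) - Num.sqrt (expR (- b))) ^+ 2
    <= expR (- M) * F * (a - b) ^+ 2.
Proof.
move=> F1 Ma Mb; rewrite !sqrt_expR.
have hE : 0 <= expR (- M) * F by rewrite mulr_ge0 ?expR_ge0// (le_trans ler01).
set s := Num.sqrt (expR (- M) * F).
have hs x : M - ln F <= x -> expR (- x / 2) <= s.
  by move=> Mx; rewrite -sqrt_expR ler_wsqrtr// likelihood_le.
have h := dist_expR_le (hs _ Ma) (hs _ Mb).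
rewrite -(sqr_sqrtr hE) -exprMn -[leLHS]real_normK ?num_real//.
rewrite -[leRHS]real_normK ?num_real// lerXn2r ?nnegrE//.
apply: (le_trans h); rewrite normrM (ger0_norm (sqrtr_ge0 _)).
rewrite ler_wpM2l ?sqrtr_ge0//.
have -> : - a / 2 - - b / 2 = - ((a - b) / 2) by field.
rewrite normrN normrM (gtr0_norm (_ : 0 < 2^-1)) ?invr_gt0//.
by have := normr_ge0 (a - b); lra.
Qed.

End likelihoods.

(** * Normalized functions and their distances *)

Section normalized_functions.
Context d (T : measurableType d) (R : realType).
Variable mu : {measure set T -> \bar R}.
Implicit Types f g p q v w : T -> R.

(** The larger function is nonnegative almost everywhere, so it may be replaced
    by its absolute value, which is nonnegative everywhere. *)
Lemma ae_le_integral f g : measurable_fun setT f -> (forall x, 0 <= f x) ->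
  mu.-integrable setT (EFin \o g) -> {ae mu, forall x, f x <= g x} ->
  (\int[mu]_x (f x)%:E <= \int[mu]_x (g x)%:E)%E.
Proof.
move=> mf f0 ig fg.
have mg : measurable_fun setT g by exact/measurable_EFinP/(measurable_int mu).
have mgp : measurable_fun setT (fun x => `|g x|).
  by apply: measurableT_comp => //; exact: normr_measurable.
rewrite (_ : (\int[mu]_x (g x)%:E = \int[mu]_x (`|g x|)%:E)%E); last first.
  apply: ae_eq_integral => //; [exact/measurable_EFinP..|].
  by apply: filterS fg => x fgx _ /=; rewrite ger0_norm// (le_trans (f0 x)).
apply: ae_ge0_le_integral => //=.
- by move=> x _; rewrite lee_fin.
- exact/measurable_EFinP.
- exact/measurable_EFinP.
- by apply: filterS fg => x fgx _; rewrite lee_fin (le_trans fgx)// ler_norm.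
Qed.

(** The probability density [q] is [p] divided by its mass [Z].  The relation
    is multiplicative and almost everywhere, so that [p] itself may fail to be
    measurable; [Z] is nevertheless determined, as the integral of [Z * q]. *)
Definition normalized p q (Z : R) : Prop :=
  [/\ 0 < Z, mu.-integrable setT (EFin \o q),
      (\int[mu]_x (q x)%:E = 1)%E & {ae mu, forall x, Z * q x = p x}].

Lemma normalized_measurable p q Z : normalized p q Z -> measurable_fun setT q.
Proof. by case=> _ iq _ _; exact/measurable_EFinP/(measurable_int mu). Qed.

Lemma normalized_integrableZ p q Z (a : R) : normalized p q Z ->
  mu.-integrable setT (EFin \o (fun x => a * q x)).
Proof. by case=> _ iq _ _; exact: (integrableZl measurableT a iq). Qed.

Lemma normalized_integralZ p q Z (a : R) : normalized p q Z ->
  (\int[mu]_x (a * q x)%:E = a%:E)%E.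
Proof.
case=> _ iq q1 _; under eq_integral do rewrite EFinM.
by rewrite (integralZl measurableT iq) q1 mule1.
Qed.

(** Markov's inequality for the unnormalized density. *)
Lemma normalized_ge p q Z (A : set T) (k a : R) : normalized p q Z ->
  measurable A -> mu A = a%:E -> 0 <= k -> (forall x, 0 <= p x) ->
  (forall x, A x -> k <= p x) -> k * a <= Z.
Proof.
move=> nq mA muA k0 p0 kp; have [_ _ _ pE] := nq.
have : (\int[mu]_x (k * \1_A x)%:E <= \int[mu]_x (Z * q x)%:E)%E.
  apply: ae_le_integral.
  - exact: measurable_funM.
  - by move=> x; rewrite mulr_ge0.
  - exact: normalized_integrableZ nq.
  - apply: filterS pE => x ->; rewrite indicE; case: (boolP (x \in A)).
      by rewrite inE mulr1 => /kp.
    by rewrite mulr0.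
rewrite (normalized_integralZ _ nq).
under eq_integral do rewrite EFinM.
rewrite ge0_integralZl//; last exact/measurable_EFinP.
by rewrite integral_indic// setIT muA lee_fin.
Qed.

Section two_densities.
Variables (p p' q q' : T -> R) (Z Z' : R).
Hypotheses (nq : normalized p q Z) (nq' : normalized p' q' Z').

Lemma normalized_dist_const w (I t : R) :
  mu.-integrable setT (EFin \o w) -> (\int[mu]_x (w x)%:E = I%:E)%E ->
  (forall x, `|p x - p' x| <= t * w x) -> `|Z - Z'| <= t * I.
Proof.
move=> iw wI hw; have [_ _ _ pE] := nq; have [_ _ _ pE'] := nq'.
have mq := normalized_measurable nq; have mq' := normalized_measurable nq'.
have iZ := normalized_integrableZ Z nq.
have iZ' := normalized_integrableZ Z' nq'.
have -> : `|Z - Z'| = fine `|\int[mu]_x (Z * q x - Z' * q' x)%:E|%E.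
  rewrite (integralB_EFin measurableT iZ iZ').
  by rewrite (normalized_integralZ _ nq) (normalized_integralZ _ nq').
have md : measurable_fun setT (fun x => Z * q x - Z' * q' x).
  by apply: measurable_funB; exact: measurable_funM.
rewrite -lee_fin fineK; last first.
  rewrite (integralB_EFin measurableT iZ iZ') (normalized_integralZ _ nq).
  by rewrite (normalized_integralZ _ nq').
apply: (le_trans (le_abse_integral _ _ _)) => //; first exact/measurable_EFinP.
have -> : (t * I)%:E = (\int[mu]_x (t * w x)%:E)%E.
  under [RHS]eq_integral do rewrite EFinM.
  by rewrite (integralZl measurableT iw) wI.
apply: ae_le_integral => //.
- by apply: measurableT_comp => //; exact: normr_measurable.
- exact: (integrableZl measurableT t iw).
- by apply: filterS2 pE pE' => x -> ->; exact: hw.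
Qed.

(** From Z (q - q') = (p - p') - (Z - Z') q'.  The factor 2 comes from
    the two terms, each of which contributes t I / Z. *)
Lemma normalized_L1_dist w (I t : R) :
  mu.-integrable setT (EFin \o w) -> (\int[mu]_x (w x)%:E = I%:E)%E ->
  (forall x, 0 <= p' x) -> (forall x, `|p x - p' x| <= t * w x) ->
  (\int[mu]_x (`|q x - q' x|)%:E <= (2 * (t * I / Z))%:E)%E.
Proof.
move=> iw wI p'0 hw; have ZZ' := normalized_dist_const iw wI hw.
have [Z0 _ _ pE] := nq; have [Z0' _ _ pE'] := nq'.
have mq := normalized_measurable nq; have mq' := normalized_measurable nq'.
have itw := integrableZl measurableT (t / Z) iw.
have iq' := normalized_integrableZ (`|Z - Z'| / Z) nq'.
apply: (@le_trans _ _ (\int[mu]_x (t / Z * w x + `|Z - Z'| / Z * q' x)%:E)%E).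
  apply: ae_le_integral => //.
  - apply: measurableT_comp; first exact: normr_measurable.
    exact: measurable_funB.
  - exact: (integrableD measurableT itw iq').
  - apply: filterS2 pE pE' => x qx q'x.
    have q'0 : 0 <= q' x by rewrite -(pmulr_rge0 _ Z0') q'x.
    rewrite -(ler_pM2l Z0).
    have -> : Z * (t / Z * w x + `|Z - Z'| / Z * q' x)
        = t * w x + `|Z - Z'| * q' x by field; rewrite gt_eqF.
    rewrite -[X in X * `|_|](gtr0_norm Z0) -normrM.
    have -> : Z * (q x - q' x) = (p x - p' x) - (Z - Z') * q' x.
      by rewrite -qx -q'x; ring.
    apply: (le_trans (ler_normB _ _)); rewrite lerD//.
    by rewrite normrM (ger0_norm q'0).
rewrite (integralD_EFin measurableT itw iq') (normalized_integralZ _ nq').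
rewrite (integralZl measurableT iw) wI -EFinM -EFinD lee_fin.
have -> : 2 * (t * I / Z) = t / Z * I + t * I / Z by ring.
by rewrite lerD2l ler_pM2r// invr_gt0.
Qed.

(** Normalizing costs only the factor 1 / sqrt (Z Z'), because what is lost in
    the identity (sqrt p - sqrt p')^2 = s (sqrt q - sqrt q')^2 + (Z - s) q
    + (Z' - s) q', where s = sqrt (Z Z'), has the nonnegative integral
    (sqrt Z - sqrt Z')^2. *)
Lemma normalized_Hellinger_dist v (J t : R) :
  mu.-integrable setT (EFin \o v) -> (\int[mu]_x (v x)%:E = J%:E)%E ->
  (forall x, 0 <= p x) -> (forall x, 0 <= p' x) ->
  (forall x, (Num.sqrt (p x) - Num.sqrt (p' x)) ^+ 2 <= t * v x) ->
  (\int[mu]_x ((Num.sqrt (q x) - Num.sqrt (q' x)) ^+ 2)%:E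
    <= (t * J / (Num.sqrt Z * Num.sqrt Z'))%:E)%E.
Proof.
move=> iv vJ p0 p'0 hv.
have [Z0 iq _ pE] := nq; have [Z0' iq' _ pE'] := nq'.
have mq := normalized_measurable nq; have mq' := normalized_measurable nq'.
set s := Num.sqrt Z * Num.sqrt Z'.
have s0 : 0 < s by rewrite mulr_gt0// sqrtr_gt0.
have i1 := integrableZl measurableT (t / s) iv.
have i2 := normalized_integrableZ ((s - Z) / s) nq.
have i3 := normalized_integrableZ ((s - Z') / s) nq'.
have i12 := integrableD measurableT i1 i2.
apply: (@le_trans _ _ (\int[mu]_x (t / s * v x + (s - Z) / s * q x
    + (s - Z') / s * q' x)%:E)%E).
  apply: ae_le_integral => //.
  - apply: measurable_funX; apply: measurable_funB.
      apply: measurableT_comp mq; apply: continuous_measurable_fun.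
      exact: sqrt_continuous.
    apply: measurableT_comp mq'; apply: continuous_measurable_fun.
    exact: sqrt_continuous.
  - by move=> x; exact: sqr_ge0.
  - exact: (integrableD measurableT i12 i3).
  - apply: filterS2 pE pE' => x qx q'x.
    have q0 : 0 <= q x by rewrite -(pmulr_rge0 _ Z0) qx.
    have q'0 : 0 <= q' x by rewrite -(pmulr_rge0 _ Z0') q'x.
    rewrite -(ler_pM2l s0).
    have -> : s * (t / s * v x + (s - Z) / s * q x + (s - Z') / s * q' x)
      = t * v x + (s - Z) * q x + (s - Z') * q' x by field; rewrite gt_eqF.
    have := hv x; rewrite -qx -q'x (sqrtrM _ (ltW Z0)) (sqrtrM _ (ltW Z0')).
    have := sqr_sqrtr q0; have := sqr_sqrtr q'0.
    have := sqr_sqrtr (ltW Z0); have := sqr_sqrtr (ltW Z0').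
    rewrite /s.
    move: (Num.sqrt Z) (Num.sqrt Z') (Num.sqrt (q x)) (Num.sqrt (q' x)).
    (* with a^2, b^2, c^2, e^2 for Z, Z', q x, q' x, goal and hypothesis differ
       by a polynomial identity *)
    by move=> a b c e <- <- <- <-; lra.
rewrite (integralD_EFin measurableT i12 i3) (normalized_integralZ _ nq').
rewrite (integralD_EFin measurableT i1 i2) (normalized_integralZ _ nq).
rewrite (integralZl measurableT iv) vJ -EFinM -!EFinD lee_fin.
rewrite -(ler_pM2l s0).
have -> : s * (t / s * J + (s - Z) / s + (s - Z') / s)
  = t * J + (s - Z) + (s - Z') by field; rewrite gt_eqF.
have -> : s * (t * J / s) = t * J by field; rewrite gt_eqF.
have := sqr_ge0 (Num.sqrt Z - Num.sqrt Z'); rewrite sqrrB.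
by rewrite (sqr_sqrtr (ltW Z0)) (sqr_sqrtr (ltW Z0')) /s; lra.
Qed.

End two_densities.
End normalized_functions.

Lemma integrable_EFin_ge0 d (T : measurableType d) (R : realType)
    (mu : {measure set T -> \bar R}) (w : T -> R) :
  (forall x, 0 <= w x) -> mu.-integrable setT (EFin \o w) ->
  exists2 I, 0 <= I & (\int[mu]_x (w x)%:E = I%:E)%E.
Proof.
move=> w0 iw; exists (fine (\int[mu]_x (w x)%:E)%E).
  by apply: fine_ge0; apply: integral_ge0 => x _; rewrite lee_fin.
by rewrite fineK//; exact: integrable_fin_num iw.
Qed.

Section distances_of_normalized.
Context d (T : measurableType d) (R : realType).
Variables (mu mu1 mu2 : probability T R) (p p' q q' : T -> R) (Z Z' z : R).
Hypotheses (d1 : density mu mu1 = EFin \o q) (d2 : density mu mu2 = EFin \o q').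
Hypotheses (nq : normalized mu p q Z) (nq' : normalized mu p' q' Z').
Hypotheses (z0 : 0 < z) (zZ : z <= Z) (zZ' : z <= Z').
Hypotheses (p0 : forall x, 0 <= p x) (p'0 : forall x, 0 <= p' x).

Lemma dTV_le (w : T -> R) (I t : R) : 0 <= I -> 0 <= t ->
  mu.-integrable setT (EFin \o w) -> (\int[mu]_x (w x)%:E = I%:E)%E ->
  (forall x, `|p x - p' x| <= t * w x) ->
  (dTV mu mu1 mu2 <= (t * I / z)%:E)%E.
Proof.
move=> I0 t0 iw wI hw; rewrite /dTV d1 d2.
have := normalized_L1_dist nq nq' iw wI p'0 hw.
have [Z0 _ _ _] := nq.
set J := (X in (X <= _)%E) => h.
apply: (@le_trans _ _ ((2^-1)%:E * (2 * (t * I / Z))%:E)%E).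
  by rewrite lee_pmul2l.
rewrite -EFinM lee_fin mulKf ?pnatr_eq0// ler_wpM2l ?mulr_ge0//.
by rewrite lef_pV2.
Qed.

Lemma dH_le (v : T -> R) (J t : R) : 0 <= J -> 0 <= t ->
  mu.-integrable setT (EFin \o v) -> (\int[mu]_x (v x)%:E = J%:E)%E ->
  (forall x, (Num.sqrt (p x) - Num.sqrt (p' x)) ^+ 2 <= t ^+ 2 * v x) ->
  (dH mu mu1 mu2 <= (t * Num.sqrt (J / z))%:E)%E.
Proof.
move=> J0 t0 iv vJ hv; rewrite /dH d1 d2.
have [Z0 _ _ _] := nq; have [Z0' _ _ _] := nq'.
have h := normalized_Hellinger_dist nq nq' iv vJ p0 p'0 hv.
have Jz : 0 <= t ^+ 2 * J / z by rewrite divr_ge0 ?mulr_ge0 ?sqr_ge0// ltW.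
have zs : z <= Num.sqrt Z * Num.sqrt Z'.
  rewrite -[leLHS](sqr_sqrtr (ltW z0)) expr2.
  by apply: ler_pM => //; rewrite ler_wsqrtr.
apply: (@le_trans _ _ (sqrte (t ^+ 2 * J / z)%:E)); last first.
  by rewrite /= -mulrA sqrtrM ?sqr_ge0// sqrtr_sqr ger0_norm.
rewrite lee_sqrt//.
apply: (@le_trans _ _ ((2^-1)%:E * (t ^+ 2 * J / z)%:E)%E).
  rewrite lee_pmul2l//.
  rewrite (eq_integral (fun x => ((Num.sqrt (q x) - Num.sqrt (q' x)) ^+ 2)%:E)).
    2: by move=> x _; rewrite EFin_expe.
  apply: (le_trans h); rewrite lee_fin ler_wpM2l ?mulr_ge0 ?sqr_ge0//.
  by rewrite lef_pV2 ?posrE// mulr_gt0 ?sqrtr_gt0.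
by rewrite -EFinM lee_fin; lra.
Qed.

End distances_of_normalized.

(** * Posteriors as normalized likelihoods *)

(** If the evidence were 0 or +oo, then the density would be almost everywhere
    +oo or 0 respectively, and would not integrate to 1.  Hence the mere
    existence of the posterior makes the evidence a positive real number. *)
Lemma posterior_normalized d (T : measurableType d) (R : realType) (Y : Type)
    (mu0 muy : probability T R) (Phi : T -> Y -> R) (y : Y) :
  is_posterior mu0 Phi y muy -> exists q Z,
    density mu0 muy = EFin \o q /\
    normalized mu0 (fun u => expR (- Phi u y)) q Z.
Proof.
case=> dom dE.
set D := density mu0 muy in dE *.
have iD : mu0.-integrable setT D by exact: Radon_Nikodym_integrable.
have mD : measurable_fun setT D := measurable_int _ iD.
have D1 : (\int[mu0]_x D x = 1)%E.
  rewrite -[RHS](probability_setT muy).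
  by rewrite -(@Radon_Nikodym_integral _ _ _ (charge_of_finite_measure muy)).
have DE : D = EFin \o (fine \o D).
  apply/funext => x /=; rewrite fineK//; exact: Radon_Nikodym_fin_num.
have E0 : (0 <= evidence mu0 Phi y)%E.
  by apply: integral_ge0 => u _; rewrite lee_fin expR_ge0.
have absurd_cst (c : \bar R) : (forall u, (evidence mu0 Phi y)^-1%E *
    (expR (- Phi u y))%:E = c)%E -> c = 1%E.
  move=> hc; rewrite -D1 (ae_eq_integral (cst c))//.
    rewrite integral_cst// -[LHS]mule1; congr (_ * _)%E.
    exact/esym/(probability_setT mu0).
  by apply: filterS dE => x -> _; rewrite hc.
move: E0 dE absurd_cst; case: (evidence mu0 Phi y) => [Z| |]//.
- rewrite lee_fin le_eqVlt => /predU1P[<- _|Z0 dE _].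
    move=> /(_ +oo%E); rewrite inve0 => h.
    suff /h : (forall u, +oo * (expR (- Phi u y))%:E = +oo)%E by [].
  by move=> u; rewrite gt0_mulye// lte_fin expR_gt0.
  exists (fine \o D), Z; split=> //; split=> //.
  + by rewrite -DE.
  + by rewrite -D1 [in RHS]DE.
  + apply: filterS dE => x /= ->; rewrite inver gt_eqF// -EFinM /=.
    by rewrite mulrA divff ?mul1r// gt_eqF.
- move=> _ _ /(_ 0%E); rewrite invey => h.
  by have /esym/eqP := h (fun u => mul0e _); rewrite onee_eq0.
Qed.

(** * Lower bound on the evidence *)

Section completed_borel.
Context (R : realType) (X : completeNormedModType R).
Variable mu0 : probability (borel X) R.

Lemma measurable_completed_ball (r : R) :
  measurable ([set u : X | `|u| < r] : set (completed_type mu0)).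
Proof.
apply: caratheodory_measurable_mu_ext.
apply: sub_sigma_algebra.
rewrite (_ : [set u | _] = ball (0 : X) r); first exact: ball_open.
by apply/seteqP; split => u /=; rewrite -ball_normE /= sub0r normrN.
Qed.

(** Balls around the origin exhaust the space, which has mass 1. *)
Lemma exists_ball_gt0 (r : R) : exists2 s, r <= s &
  exists2 a : R, 0 < a & completion mu0 [set u : X | `|u| < s] = a%:E.
Proof.
pose F n := [set u : X | `|u| < r + n%:R] : set (completed_type mu0).
have mF n : measurable (F n) by exact: measurable_completed_ball.
have [n Fn] : exists n, completion mu0 (F n) != 0%E.
  apply: contrapT => /forallNP F0.
  have : (completion mu0).-negligible (\bigcup_n F n).
    apply: negligible_bigcup => n; exists (F n); split=> //.
    by exact/eqP/negbNE/negP/F0.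
  have -> : \bigcup_n F n = setT.
    apply/seteqP; split=> // u _.
    exists (Num.truncn (`|u : X| - r)).+1 => //=.
    change (`|u : X| < r + (Num.truncn (`|u : X| - r)).+1%:R).
    by rewrite -ltrBlDl truncnS_gt.
  move=> [A [mA A0 sA]].
  have := probability_setT (completion mu0).
  have -> : [set: completed_type mu0] = A by apply/seteqP; split.
  by rewrite A0 => /esym/eqP; rewrite onee_eq0.
exists (r + n%:R); first by rewrite lerDl.
have fF : completion mu0 (F n) \is a fin_num by exact: fin_num_measure.
exists (fine (completion mu0 (F n))); last by rewrite fineK.
by rewrite fine_gt0// lt0e Fn measure_ge0 /= ltey_eq fF.
Qed.

End completed_borel.

Section completed_posteriors.
Context (R : realType) (X Y : completeNormedModType R).
Variables (mu0 : probability (borel X) R) (Phi : X -> Y -> R).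

(** The radius [s] of a ball of positive mass may exceed [r], and condition (B)
    is used at [s], which also covers every [y] of norm less than [r]. *)
Lemma evidence_lower_bound
    (condB : forall r : R, 0 < r -> exists K : R, 0 < K /\
       forall (u : X) (y : Y), `|u| < r -> `|y| < r -> Phi u y <= K) (r : R) :
  0 < r -> exists2 z : R, 0 < z & forall y q Z, `|y| < r ->
    normalized (completion mu0) (fun u => expR (- Phi u y)) q Z -> z <= Z.
Proof.
move=> r0; have [s rs [a a0 sa]] := exists_ball_gt0 mu0 r.
have [K [_ hK]] := condB s (lt_le_trans r0 rs).
exists (expR (- K) * a); first by rewrite mulr_gt0// expR_gt0.
move=> y q Z yr nq; apply: (normalized_ge nq _ sa).
- exact: measurable_completed_ball.
- exact: expR_ge0.
- by move=> u; exact: expR_ge0.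
- by move=> u us; rewrite ler_expR lerN2 hK// (lt_le_trans yr).
Qed.

End completed_posteriors.

(** * Local Lipschitz continuity of the posterior *)

Unset Implicit Arguments.
Set Strict Implicit.

Theorem theorem4p3 (R : realType) (X Y : completeNormedModType R)
    (mu0 : probability (borel X) R) (Phi : X -> Y -> R) (f1 f2 : R -> R)
    (f1_ge1 : forall t : R, 0 <= t -> 1 <= f1 t)
    (f1_nd : forall s t : R, 0 <= s -> s <= t -> f1 s <= f1 t)
    (condA : forall r : R, 0 < r -> exists M : R, forall (u : X) (y : Y),
       `|y| < r -> M - ln (f1 `|u|) <= Phi u y)
    (condB : forall r : R, 0 < r -> exists K : R, 0 < K /\
       forall (u : X) (y : Y), `|u| < r -> `|y| < r -> Phi u y <= K)
    (f2_gt0 : forall t : R, 0 <= t -> 0 < f2 t)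
    (f2_nd : forall s t : R, 0 <= s -> s <= t -> f2 s <= f2 t)
    (condC : forall r : R, 0 < r -> exists C : R, forall (y1 y2 : Y) (u : X),
       `|y1| < r -> `|y2| < r ->
       `|Phi u y1 - Phi u y2| <= C * f2 `|u| * `|y1 - y2|) :
  ((completion mu0).-integrable [set: X]
     (fun u : X => (f2 `|u| * f1 `|u|)%:E) ->
   forall r : R, 0 < r -> exists C : R, 0 < C /\
     forall y y' : Y, `|y| < r -> `|y'| < r ->
     forall muy muy' : probability (completed_type mu0) R,
       is_posterior (completion mu0) Phi y muy ->
       is_posterior (completion mu0) Phi y' muy' ->
       (dTV (completion mu0) muy muy' <= (C * `|y - y'|)%:E)%E)
  /\
  ((completion mu0).-integrable [set: X]
     (fun u : X => (f2 `|u| ^+ 2 * f1 `|u|)%:E) ->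
   forall r : R, 0 < r -> exists C' : R, 0 < C' /\
     forall y y' : Y, `|y| < r -> `|y'| < r ->
     forall muy muy' : probability (completed_type mu0) R,
       is_posterior (completion mu0) Phi y muy ->
       is_posterior (completion mu0) Phi y' muy' ->
       (dH (completion mu0) muy muy' <= (C' * `|y - y'|)%:E)%E).
Proof.
(* the constant of condition (C) can be negative when Y is trivial *)
have dPhi (r : R) : 0 < r -> exists2 C : R, 0 <= C & forall (y1 y2 : Y) (u : X),
    `|y1| < r -> `|y2| < r ->
    `|Phi u y1 - Phi u y2| <= C * f2 `|u| * `|y1 - y2|.
  move=> r0; have [C hC] := condC r r0; exists `|C| => // y1 y2 u y1r y2r.
  apply: (le_trans (hC _ _ _ y1r y2r)); rewrite ler_wpM2r//.
  by rewrite ler_wpM2r ?ler_norm// ltW// f2_gt0.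
have f1_gt0 u : 0 < f1 `|u : X| by rewrite (lt_le_trans ltr01)// f1_ge1.
split=> iw r r0; have [M hM] := condA r r0; have [C C0 hC] := dPhi r r0;
  have [z z0 hz] := evidence_lower_bound mu0 condB r0.
- have [|I I0 wI] := integrable_EFin_ge0 (mu := completion mu0)
    (w := fun u : X => f2 `|u| * f1 `|u|) _ iw.
    by move=> u; rewrite mulr_ge0 ?ltW ?f2_gt0.
  (* adding 1 makes the constant positive even if C = 0 *)
  exists (expR (- M) * C * I / z + 1); split.
    by rewrite ltr_wpDl// divr_ge0 ?mulr_ge0 ?expR_ge0// ltW.
  move=> y y' yr y'r muy muy' py py'.
  have [q [Z [dq nq]]] := posterior_normalized py.
  have [q' [Z' [dq' nq']]] := posterior_normalized py'.
  have K0 : 0 <= expR (- M) * C * `|y - y'| by rewrite !mulr_ge0 ?expR_ge0.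
  apply: (@le_trans _ _ (expR (- M) * C * `|y - y'| * I / z)%:E).
    apply: (dTV_le dq dq' nq nq' z0 (hz _ _ _ yr nq) _ I0 K0 iw wI).
      by move=> u; exact: expR_ge0.
    move=> u; apply: (le_trans (likelihood_dist_le (f1_ge1 _ (normr_ge0 u))
      (hM u y yr) (hM u y' y'r))).
    have -> : expR (- M) * C * `|y - y'| * (f2 `|u| * f1 `|u|) =
      expR (- M) * f1 `|u| * (C * f2 `|u| * `|y - y'|) by ring.
    by rewrite ler_wpM2l ?hC// mulr_ge0 ?expR_ge0// ltW.
  rewrite lee_fin mulrDl mul1r.
  have -> : expR (- M) * C * I / z * `|y - y'| =
    expR (- M) * C * `|y - y'| * I / z by ring.
  by rewrite lerDl.
- have [|J J0 vJ] := integrable_EFin_ge0 (mu := completion mu0)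
    (w := fun u : X => f2 `|u| ^+ 2 * f1 `|u|) _ iw.
    by move=> u; rewrite mulr_ge0 ?sqr_ge0// ltW.
  set B := Num.sqrt (expR (- M)) * C.
  have B0 : 0 <= B by rewrite mulr_ge0 ?sqrtr_ge0.
  exists (B * Num.sqrt (J / z) + 1); split.
    by rewrite ltr_wpDl// mulr_ge0 ?sqrtr_ge0.
  move=> y y' yr y'r muy muy' py py'.
  have [q [Z [dq nq]]] := posterior_normalized py.
  have [q' [Z' [dq' nq']]] := posterior_normalized py'.
  have K0 : 0 <= B * `|y - y'| by rewrite mulr_ge0.
  apply: (@le_trans _ _ (B * `|y - y'| * Num.sqrt (J / z))%:E).
    apply: (dH_le dq dq' nq nq' z0 (hz _ _ _ yr nq) (hz _ _ _ y'r nq')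
      _ _ J0 K0 iw vJ); [by move=> u; exact: expR_ge0..|].
    move=> u; apply: (le_trans (sqrt_likelihood_dist_le (f1_ge1 _ (normr_ge0 u))
      (hM u y yr) (hM u y' y'r))).
    have -> : (B * `|y - y'|) ^+ 2 * (f2 `|u| ^+ 2 * f1 `|u|) =
        expR (- M) * f1 `|u| * (C * f2 `|u| * `|y - y'|) ^+ 2.
      by rewrite /B -[expR (- M) in RHS]sqr_sqrtr ?expR_ge0//; ring.
    have E0 : 0 <= expR (- M) * f1 `|u| by rewrite mulr_ge0 ?expR_ge0// ltW.
    rewrite ler_wpM2l//.
    rewrite -[leLHS]real_normK ?num_real// lerXn2r ?nnegrE ?hC//.
    by rewrite !mulr_ge0// ltW// f2_gt0.
  rewrite lee_fin mulrDl mul1r.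
  have -> : B * `|y - y'| * Num.sqrt (J / z) =
    B * Num.sqrt (J / z) * `|y - y'| by ring.
  by rewrite lerDl.
Qed.
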